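(* Let $T\ge 1$, let $\Sigma_u$ be a symmetric positive definite $T\times T$ matrix, and let $\mathcal{U}$ be a Gaussian process on $\mathbb{R}^T\times\mathbb{R}^T$ with stationary squared exponential covariance $$k_u([x,y],[v,w])=\sigma_u^2\exp\left(-\tfrac12 (x-v)^\intercal\Sigma_u^{-1}(x-v)-\tfrac12 (y-w)^\intercal\Sigma_u^{-1}(y-w)\right),\qquad \sigma_u>0.$$ Let $\mathcal{F}(x,y)=\mathcal{U}(x,y)-\mathcal{U}(y,x)$ and assume $\mathbb{E}[\mathcal{F}(x,y)]=0$ for all $x,y$. Let the attributes be i.i.d. multivariate Gaussian with covariance $\Sigma_x=\sigma_x^2 I$, drawn independently of $\mathcal{F}$. Suppose $R=\Sigma_u^{-1}\Sigma_x=r^2 I$ for some scalar $r>0$. Then the shared-endpoint correlation is $$\rho(r)=\frac{(1+2r^2)^{-T/2}-(1+r^2)^{-T/2}(1+3r^2)^{-T/2}}{1-(1+4r^2)^{-T/2}}.$$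
   Context: Let $X,Y,W$ be i.i.d. draws from the attribute distribution $\pi_X$, independent of the random skew-symmetric function $\mathcal{F}$. The variance and the shared-endpoint correlation are $$\sigma^2=\mathbb{E}_{\mathcal{F}}\left[\mathrm{Var}_{X,Y}(\mathcal{F}(X,Y)\mid\mathcal{F})\right],\qquad \rho=\frac{1}{\sigma^2}\,\mathbb{E}_{\mathcal{F}}\left[\mathrm{Cov}_{X,Y,W}(\mathcal{F}(X,Y),\mathcal{F}(X,W)\mid\mathcal{F})\right].$$ The number $r$ (the positive square root of the repeated eigenvalue of $R$) is called the roughness coefficient. *)

(* Defs.v *)
From HB Require Import structures.
From mathcomp Require Import all_boot all_order all_algebra.
From mathcomp Require Import all_classical all_reals all_analysis.

Set Implicit Arguments.
Unset Strict Implicit.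
Unset Printing Implicit Defensive.

Import Order.TTheory GRing.Theory Num.Theory.
Import numFieldNormedType.Exports.

Local Open Scope classical_set_scope.
Local Open Scope ring_scope.

(* Points of R^n are n-tuples, which carry the product sigma-algebra; matrix
   algebra is done on the associated column vectors. *)
Definition colv (R : realType) (n : nat) (x : n.-tuple R) : 'cV[R]_n :=
  \col_i tnth x i.

Definition quad (R : realType) (n : nat) (A : 'M[R]_n) (v : 'cV[R]_n) : R :=
  (v^T *m A *m v) ord0 ord0.

Definition posdef (R : realType) (n : nat) (A : 'M[R]_n) : Prop :=
  A^T = A /\ forall v : 'cV[R]_n, v != 0 -> 0 < quad A v.

(* Lebesgue integral over R^n of a nonnegative measurable function, as an
   iterated integral. *)
Fixpoint integral_tuple (R : realType) (n : nat) :
    (n.-tuple R -> \bar R) -> \bar R :=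
  match n with
  | 0 => fun f => f [tuple]
  | m.+1 => fun f => (\int[lebesgue_measure]_t
      integral_tuple (fun v : m.-tuple R => f (cons_tuple t v)))%E
  end.

Definition mvnormal_pdf (R : realType) (n : nat) (m : 'cV[R]_n) (S : 'M[R]_n)
    (x : n.-tuple R) : R :=
  (Num.sqrt ((2 * pi) ^+ n * \det S))^-1 *
  expR (- 2^-1 * quad (invmx S) (colv x - m)).

(* X has the (nondegenerate) multivariate normal law with mean m and positive
   definite covariance S. *)
Definition mvnormal (d : measure_display) (Omega : measurableType d)
    (R : realType) (P : probability Omega R) (n : nat)
    (X : Omega -> n.-tuple R) (m : 'cV[R]_n) (S : 'M[R]_n) : Prop :=
  forall B : set (n.-tuple R), measurable B ->
    P (X @^-1` B) =
    integral_tuple (fun x => (mvnormal_pdf m S x * \1_B x)%:E).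

(* The degenerate case needs its own clause: [normal_prob m 0] is not the Dirac
   mass at m but the uniform law on [0, 1]. *)
Definition is_normal (d : measure_display) (Omega : measurableType d)
    (R : realType) (P : probability Omega R) (Z : Omega -> R) : Prop :=
  exists m s : R, 0 <= s /\
    forall B : set R, measurable B ->
      P (Z @^-1` B) = if s == 0 then \d_m B else normal_prob m s B.

Definition gaussian_process (d : measure_display) (Omega : measurableType d)
    (R : realType) (P : probability Omega R) (I : Type)
    (U : I -> {RV P >-> R}) : Prop :=
  forall (n : nat) (t : 'I_n -> I) (c : 'I_n -> R),
    is_normal P (fun w => \sum_(i < n) c i * U (t i) w).

Definition se_kernel (R : realType) (n : nat) (su : R) (Su : 'M[R]_n)
    (p q : n.-tuple R * n.-tuple R) : R :=
  su ^+ 2 * expR (- 2^-1 * quad (invmx Su) (colv p.1 - colv q.1)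
                  - 2^-1 * quad (invmx Su) (colv p.2 - colv q.2)).

Definition skew_diff (Omega V : Type) (R : realType) (U : V * V -> Omega -> R)
    (p : V * V) (w : Omega) : R :=
  U p w - U (p.2, p.1) w.

(* Generators of the sigma-algebra sigma(F) of a random function F. *)
Definition events_of (R : realType) (Omega I : Type) (F : I -> Omega -> R) :
    set (set Omega) :=
  [set A | exists (p : I) (B : set R), measurable B /\ A = F p @^-1` B].

(* Joint measurability in (index, outcome), where outcomes are observed through
   F only; this is what makes F (X, Y) a random variable and makes independence
   from sigma(F) meaningful for it. It holds e.g. for continuous paths. *)
Definition measurable_random_function (R : realType) (d d' : measure_display)
    (Omega : measurableType d) (I : measurableType d') (F : I -> Omega -> R) :
    Prop :=
  measurable_fun [set: I * g_sigma_algebraType (events_of F)]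
    (fun z : I * g_sigma_algebraType (events_of F) => F z.1 z.2).

Definition mutually_independent3 (d d' : measure_display)
    (Omega : measurableType d) (V : measurableType d') (R : realType)
    (P : probability Omega R) (X Y W : Omega -> V) : Prop :=
  forall A B C : set V, measurable A -> measurable B -> measurable C ->
    P (X @^-1` A `&` Y @^-1` B `&` W @^-1` C) =
    (P (X @^-1` A) * P (Y @^-1` B) * P (W @^-1` C))%E.

Definition independent_of_events (d d' : measure_display)
    (Omega : measurableType d) (V : measurableType d') (R : realType)
    (P : probability Omega R) (G : set (set Omega)) (Z : Omega -> V) : Prop :=
  forall (A : set Omega) (C : set V), G A -> measurable C ->
    P (A `&` Z @^-1` C) = (P A * P (Z @^-1` C))%E.

(* Z is a version of the conditional expectation E[V | G]. *)
Definition is_cond_exp (d : measure_display) (Omega : measurableType d)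
    (R : realType) (P : probability Omega R) (G : set (set Omega))
    (V Z : Omega -> R) : Prop :=
  [/\ forall B : set R, measurable B -> G (Z @^-1` B),
      P.-integrable [set: Omega] (EFin \o Z) &
      forall A : set Omega, G A ->
        (\int[P]_(w in A) (Z w)%:E = \int[P]_(w in A) (V w)%:E)%E].

(* A chosen version (0 if there is none). *)
Definition cond_exp (d : measure_display) (Omega : measurableType d)
    (R : realType) (P : probability Omega R) (G : set (set Omega))
    (V : Omega -> R) : Omega -> R :=
  xget (fun=> 0) [set Z | is_cond_exp P G V Z].

Definition cond_cov (d : measure_display) (Omega : measurableType d)
    (R : realType) (P : probability Omega R) (G : set (set Omega))
    (V1 V2 : Omega -> R) : Omega -> R :=
  cond_exp P G (fun w => (V1 w - cond_exp P G V1 w) *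
                         (V2 w - cond_exp P G V2 w)).

Definition cond_var (d : measure_display) (Omega : measurableType d)
    (R : realType) (P : probability Omega R) (G : set (set Omega))
    (V : Omega -> R) : Omega -> R :=
  cond_cov P G V V.

Definition sigma_of (R : realType) (Omega I : Type) (F : I -> Omega -> R) :
    set (set Omega) := <<s events_of F >>.

Definition eval_at (Omega V : Type) (R : realType) (F : V * V -> Omega -> R)
    (X Y : Omega -> V) : Omega -> R :=
  fun w => F (X w, Y w) w.

Definition variance_F (d : measure_display) (Omega : measurableType d)
    (R : realType) (P : probability Omega R) (V : Type)
    (F : V * V -> Omega -> R) (X Y : Omega -> V) : R :=
  fine ('E_P[cond_var P (sigma_of F) (eval_at F X Y)])%E.

Definition shared_endpoint_correlation (d : measure_display)
    (Omega : measurableType d) (R : realType) (P : probability Omega R)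
    (V : Type) (F : V * V -> Omega -> R) (X Y W : Omega -> V) : R :=
  (variance_F P F X Y)^-1 *
  fine ('E_P[cond_cov P (sigma_of F) (eval_at F X Y) (eval_at F X W)])%E.

(* Main.v *)
From HB Require Import structures.
Require Import Defs.
From mathcomp Require Import all_boot all_order all_algebra.
From mathcomp Require Import all_classical all_reals all_analysis.
From mathcomp Require Import measurable_realfun.
From mathcomp Require Import ring.
Import Order.TTheory GRing.Theory Num.Theory.
Import numFieldNormedType.Exports.
Local Open Scope classical_set_scope.
Local Open Scope ring_scope.

(* Given F, the conditional mean of F(X,Y) vanishes: (X,Y) and (Y,X) have the
   same law given F, while F is skew. Hence the conditional variance and
   covariance have expectations E[F(X,Y)^2] and E[F(X,Y)F(X,W)], which by
   Fubini are the integrals over the attributes of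
     E[F(x,y)F(x,u)] = 2 su^2 (g(y,u) - g(x,u) g(x,y)),
     g(x,y) = exp(- (r/sx)^2 |x-y|^2 / 2),
   and these are products of one-dimensional Gaussian integrals, done by
   completing the square. *)

(** The obstacle is conditional expectation. [cond_exp] is an arbitrary choice among versions, and 0
    if there are none, so every conditional mean and covariance needs an actual version and a.e.
    uniqueness. Versions come from freezing: [P] is restricted to the sigma-algebra of [F], and
    independence says that an outcome seen through [F] and the attributes have a product law.
    Integrating out the attributes for a fixed outcome then gives a version. Freezing needs
    integrability, which comes from a bound on the second moment of [F p] that is uniform in [p].

    The Gaussian computation rests on a closed family: the kernels g with arbitrary precision [a]
    are stable under products (precisions add) and under integrating out one attribute ([a] becomes
    [a / (1 + a * s ^+ 2)], up to a constant factor). The last attribute is integrated against a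
    kernel centred at the mean [mu], so [mu] disappears from the result. *)

Definition mfun_of {d1 d2} {T1 : measurableType d1} {T2 : measurableType d2}
    {f : T1 -> T2} (mf : measurable_fun setT f) : {mfun T1 >-> T2} :=
  HB.pack f (isMeasurableFun.Build _ _ _ _ _ mf).

(** * Normal laws on R and on tuples *)

Lemma ge0_integral_normal_prob {R : realType} (m s : R) (f : R -> \bar R) :
  measurable_fun [set: R] f -> (forall x, 0 <= f x)%E ->
  (\int[normal_prob m s]_x f x =
   \int[lebesgue_measure]_x ((normal_pdf m s x)%:E * f x))%E.
Proof.
move=> mf f0.
have dom := normal_prob_dominates m s.
rewrite -(Radon_Nikodym_SigmaFinite.change_of_variables dom f0 measurableT mf).
apply: ae_eq_integral => //.
- apply: emeasurable_funM => //; apply: (measurable_int lebesgue_measure).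
  exact: Radon_Nikodym_SigmaFinite.f_integrable.
- apply: emeasurable_funM => //; apply/measurable_EFinP.
  exact: measurable_normal_pdf.
- rewrite (_ : (fun x => (normal_pdf m s x)%:E * f x)%E =
      (f \* (EFin \o normal_pdf m s))%E); last first.
    by apply/funext => x; rewrite muleC.
  apply: ae_eqe_mul2l.
  (* The Radon-Nikodym derivative and [normal_pdf] have the same integral over every measurable set,
     hence agree a.e. *)
  apply: integral_ae_eq => //.
  + exact: Radon_Nikodym_SigmaFinite.f_integrable.
  + by apply/measurable_EFinP; exact: measurable_normal_pdf.
  + by move=> E _ mE; rewrite -Radon_Nikodym_SigmaFinite.f_integral.
Qed.

Lemma prod_cons_tuple {R : realType} {n} (h : 'I_n.+1 -> R -> R) t
    (v : n.-tuple R) :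
  \prod_(i < n.+1) h i (tnth (cons_tuple t v) i) =
  h ord0 t * \prod_(i < n) h (lift ord0 i) (tnth v i).
Proof.
rewrite big_ord_recl; congr (h _ _ * _).
by apply: eq_bigr => i _; rewrite tnthS.
Qed.

(** The factor [a] carries the induction: for the inner integrals [h ord0 t] is a constant, which
    [a] absorbs. *)
Lemma integral_tuple_prod {R : realType} {n} (h : 'I_n -> R -> R)
    (c : 'I_n -> R) (a : R) :
  0 <= a -> (forall i, measurable_fun setT (h i)) ->
  (forall i x, 0 <= h i x) ->
  (forall i, (\int[lebesgue_measure]_x (h i x)%:E = (c i)%:E)%E) ->
  integral_tuple (fun x : n.-tuple R => (a * \prod_(i < n) h i (tnth x i))%:E) =
  (a * \prod_(i < n) c i)%:E.
Proof.
elim: n h c a => [|n IH] h c a a0 mh h0 hc /=; first by rewrite !big_ord0.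
have prod0 : 0 <= \prod_(i < n) c (lift ord0 i).
  apply: prodr_ge0 => i _; rewrite -lee_fin -hc.
  by apply: integral_ge0 => x _; rewrite lee_fin.
transitivity (\int[lebesgue_measure]_t
    ((a * \prod_(i < n) c (lift ord0 i))%:E * (h ord0 t)%:E))%E.
  apply: eq_integral => t _.
  rewrite [X in integral_tuple X](_ : _ = fun v : n.-tuple R =>
      (a * h ord0 t * \prod_(i < n) h (lift ord0 i) (tnth v i))%:E); last first.
    by apply/funext => v; rewrite prod_cons_tuple mulrA.
  rewrite (IH (fun i => h (lift ord0 i)) (fun i => c (lift ord0 i)))
    ?mulr_ge0//.
  by rewrite -EFinM mulrAC.
rewrite ge0_integralZl_EFin//; last by rewrite mulr_ge0.
- by rewrite hc -EFinM big_ord_recl -mulrA [c _ * _]mulrC.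
- by move=> x _; rewrite lee_fin.
- by apply/measurable_EFinP; exact: mh.
Qed.

(** [integral_tuple] is a recursion on functions, not an integral against a measure. A genuine
    probability behind it gives access to measure theory; it is built as the image under cons of the
    product of a one-dimensional normal law and the law of the tail. *)
Lemma normal_tuple_prob_exists {R : realType} {n} (m : 'I_n -> R) (s : R) :
  exists nu : probability (n.-tuple R) R, forall f : n.-tuple R -> \bar R,
    measurable_fun setT f -> (forall x, 0 <= f x)%E ->
    (\int[nu]_x f x = integral_tuple (fun x : n.-tuple R =>
      (\prod_(i < n) normal_pdf (m i) s (tnth x i))%:E * f x))%E.
Proof.
elim: n m => [|n IH] m.
  exists (dirac [tuple]) => f mf f0 /=.
  by rewrite integral_dirac// diracT mul1e big_ord0 mul1e.
have [nu nuE] := IH (fun i => m (lift ord0 i)).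
have mc : measurable_fun setT
    (fun p : measurableTypeR R * n.-tuple R => cons_tuple p.1 p.2 : n.+1.-tuple R).
  exact: measurable_cons.
pose phi := mfun_of mc.
exists (distribution (normal_prob (m ord0) s \x nu)%E phi) => f mf f0.
rewrite ge0_integral_distribution//.
have mfphi : measurable_fun setT (f \o phi) by exact: measurableT_comp.
rewrite fubini_tonelli1//=.
rewrite ge0_integral_normal_prob; last 2 first.
- by apply: measurable_fun_fubini_tonelli_F => // z; exact: f0.
- by move=> x; apply: integral_ge0 => y _; exact: f0.
apply: eq_integral => t _.
have p0 : (0 <= (normal_pdf (m ord0) s t)%:E)%E.
  by rewrite lee_fin normal_pdf_ge0.
have mft : measurable_fun setT (fun v : n.-tuple R => f (cons_tuple t v)).
  apply: (measurableT_comp mf (_ : measurable_fun setT (fun v : n.-tuple R =>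
    cons_tuple t v : n.+1.-tuple R))).
  exact: measurable_cons.
rewrite /fubini_F -ge0_integralZl//=.
rewrite nuE; last 2 first.
- by apply: emeasurable_funM => //; exact: mft.
- by move=> x; rewrite mule_ge0.
congr integral_tuple; apply/funext => v.
rewrite muleA -EFinM; congr (_%:E * _)%E.
by rewrite (prod_cons_tuple (fun i => normal_pdf (m i) s)) mulrC.
Qed.

(** For [a] nonzero, [a / (1 + a * v)] is the inverse of 1/a + v, the variance of a convolution. The
    last term has the mean and variance of the posterior for prior N(m, v) and an observation [b] of
    precision [a]. *)
Lemma complete_square {R : realFieldType} (m b x a v : R) :
  v != 0 -> 1 + a * v != 0 ->
  - (x - m) ^+ 2 / (v *+ 2) + - a * (x - b) ^+ 2 / 2 =
  - (a / (1 + a * v)) * (m - b) ^+ 2 / 2 +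
  - (x - (m + a * v * b) / (1 + a * v)) ^+ 2 / ((v / (1 + a * v)) *+ 2).
Proof.
move=> v0 D0; rewrite -(mulr_natr v) -(mulr_natr (v / _)).
by field; apply/andP.
Qed.

Lemma normal_pdf_mul_gauss {R : realType} (m s a b x : R) :
  s != 0 -> 0 <= a ->
  normal_pdf m s x * expR (- a * (x - b) ^+ 2 / 2) =
  (1 + a * s ^+ 2) `^ (- 2^-1) *
    expR (- (a / (1 + a * s ^+ 2)) * (m - b) ^+ 2 / 2) *
  normal_pdf ((m + a * s ^+ 2 * b) / (1 + a * s ^+ 2))
    (s / Num.sqrt (1 + a * s ^+ 2)) x.
Proof.
move=> s0 a0.
have s20 : 0 < s ^+ 2 by rewrite exprn_even_gt0.
have aux (p q u v : R) : q != 0 -> q^-1 * u * (p * q * v) = p * (u * v).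
  by move=> q0; field.
set D := 1 + a * s ^+ 2.
have D0 : 0 < D by rewrite ltr_pwDl// mulr_ge0// ltW.
have sD0 : 0 < Num.sqrt D by rewrite sqrtr_gt0.
have sDn : s / Num.sqrt D != 0 by rewrite mulf_neq0// invr_neq0// gt_eqF.
rewrite !normal_pdfE//.
have sE : (s / Num.sqrt D) ^+ 2 = s ^+ 2 / D.
  by rewrite expr_div_n sqr_sqrtr// ltW.
(* The peak is inversely proportional to the standard deviation; this is the origin of the power
   -1/2 of [D]. *)
have -> : normal_peak (s / Num.sqrt D) = normal_peak s * Num.sqrt D.
  rewrite /normal_peak sE -[X in Num.sqrt X]mulr_natr.
  rewrite (_ : s ^+ 2 / D * pi * 2%:R = (s ^+ 2 * pi *+ 2) / D); last first.
    by rewrite (mulrAC _ D^-1) (mulrAC _ D^-1) mulr_natr.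
  rewrite sqrtrM; last by rewrite mulrn_wge0// mulr_ge0 ?pi_ge0// ltW.
  by rewrite invfM sqrtrV ?invrK// ltW.
have -> : D `^ (- 2^-1) = (Num.sqrt D)^-1.
  by rewrite powRN powR12_sqrt// ltW.
rewrite /normal_fun sE.
rewrite [RHS](_ : _ = normal_peak s *
  (expR (- (a / D) * (m - b) ^+ 2 / 2) *
   expR (- (x - (m + a * s ^+ 2 * b) / D) ^+ 2 / ((s ^+ 2 / D) *+ 2)))); last first.
  by apply: aux; rewrite gt_eqF.
rewrite -(mulrA (normal_peak s)) -!expRD; congr (_ * expR _).
by rewrite complete_square// gt_eqF.
Qed.

Lemma integral_normal_pdf_gauss {R : realType} (m s a b : R) :
  s != 0 -> 0 <= a ->
  (\int[lebesgue_measure]_x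
    (normal_pdf m s x * expR (- a * (x - b) ^+ 2 / 2))%:E =
  ((1 + a * s ^+ 2) `^ (- 2^-1) *
    expR (- (a / (1 + a * s ^+ 2)) * (m - b) ^+ 2 / 2))%:E)%E.
Proof.
move=> s0 a0.
under eq_integral do rewrite normal_pdf_mul_gauss// EFinM.
rewrite ge0_integralZl_EFin//.
- by rewrite integral_normal_pdf mule1.
- by move=> x _; rewrite lee_fin normal_pdf_ge0.
- by apply/measurable_EFinP; exact: measurable_normal_pdf.
- by rewrite mulr_ge0 ?powR_ge0 ?expR_ge0.
Qed.

Lemma quad_scalar {R : realType} {n} (c : R) (v : 'cV[R]_n) :
  quad c%:M v = c * \sum_(i < n) v i ord0 ^+ 2.
Proof.
rewrite /quad mul_mx_scalar -scalemxAl mxE; congr (_ * _).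
by rewrite mxE; apply: eq_bigr => i _; rewrite mxE expr2.
Qed.

Lemma mvnormal_pdf_scalar {R : realType} {n} (mu : 'cV[R]_n) (s : R)
    (x : n.-tuple R) : s != 0 ->
  mvnormal_pdf mu (s ^+ 2)%:M x =
  \prod_(i < n) normal_pdf (mu i ord0) s (tnth x i).
Proof.
move=> s0; rewrite /mvnormal_pdf invmx_scalar quad_scalar det_scalar.
under [RHS]eq_bigr do rewrite normal_pdfE//.
rewrite big_split/= prodr_const card_ord -exprMn; congr (_ * _).
  rewrite /normal_peak exprVn; congr (_^-1).
  have p0 : 0 <= s ^+ 2 * pi *+ 2 by rewrite mulrn_wge0// mulr_ge0 ?sqr_ge0 ?pi_ge0.
  rewrite (_ : 2 * pi * s ^+ 2 = s ^+ 2 * pi *+ 2); last by ring.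
  move: (s ^+ 2 * pi *+ 2) p0 => c c0.
  elim: n {mu x} => [|n IH]; first by rewrite !expr0 sqrtr1.
  by rewrite !exprS sqrtrM ?IH.
rewrite -expR_sum; congr expR.
rewrite mulrA mulr_sumr; apply: eq_bigr => i _.
rewrite !mxE -(mulr_natr (s ^+ 2)) (invfM (s ^+ 2)) !mulNr; congr (- _).
by rewrite [RHS]mulrC [X in X * _]mulrC.
Qed.

(** The precision [a] is left free because products and integrations change it. *)
Definition gauss_kernel {R : realType} {n} (a : R) (x y : n.-tuple R) : R :=
  expR (- a * (\sum_(i < n) (tnth x i - tnth y i) ^+ 2) / 2).

Lemma gauss_kernelC {R : realType} {n} (a : R) (x y : n.-tuple R) :
  gauss_kernel a x y = gauss_kernel a y x.
Proof.
rewrite /gauss_kernel.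
rewrite (eq_bigr (fun i => (tnth y i - tnth x i) ^+ 2))// => i _.
by rewrite -sqrrN opprB.
Qed.

Lemma gauss_kernelM {R : realType} {n} (a b : R) (x y : n.-tuple R) :
  gauss_kernel a x y * gauss_kernel b x y = gauss_kernel (a + b) x y.
Proof. by rewrite /gauss_kernel -expRD; congr expR; ring. Qed.

Lemma gauss_kernelE {R : realType} {n} (a : R) (x y : n.-tuple R) :
  gauss_kernel a x y =
  \prod_(i < n) expR (- a * (tnth x i - tnth y i) ^+ 2 / 2).
Proof. by rewrite /gauss_kernel -expR_sum -mulr_suml mulr_sumr. Qed.

Lemma measurable_gauss_kernel {d} {U : measurableType d} {R : realType} {n}
    (a : R) (f g : U -> n.-tuple R) :
  measurable_fun setT f -> measurable_fun setT g ->
  measurable_fun setT (fun u => gauss_kernel a (f u) (g u)).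
Proof.
move=> /measurable_fun_tnthP mf /measurable_fun_tnthP mg.
apply: measurableT_comp => //; apply: measurable_funM => //.
apply: measurable_funM => //.
apply: measurable_sum => i; apply: measurable_funX.
by apply: measurable_funB; [exact: mf|exact: mg].
Qed.

(** [mvnormal] prescribes only probabilities of sets. Indicators identify the law of [X] with the
    probability constructed above, for which the formula holds for all nonnegative functions. *)
Lemma ge0_integral_mvnormal {d} {Omega : measurableType d} {R : realType}
    {P : probability Omega R} {n} {X : {RV P >-> n.-tuple R}} {mu : 'cV[R]_n}
    {s : R} (f : n.-tuple R -> \bar R) :
  s != 0 -> mvnormal P X mu (s ^+ 2)%:M ->
  measurable_fun setT f -> (forall x, 0 <= f x)%E ->
  (\int[distribution P X]_x f x = integral_tuple (fun x : n.-tuple R =>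
    (\prod_(i < n) normal_pdf (mu i ord0) s (tnth x i))%:E * f x))%E.
Proof.
move=> s0 hX mf f0.
have [nu nuE] := normal_tuple_prob_exists (fun i => mu i ord0) s.
rewrite -nuE//; apply: eq_measure_integral => B mB _.
transitivity (P (X @^-1` B)) => //; rewrite (hX B mB).
transitivity (\int[nu]_x (\1_B x)%:E)%E; last by rewrite integral_indic// setIT.
rewrite nuE//; last exact/measurable_EFinP.
by congr integral_tuple; apply/funext => x; rewrite EFinM mvnormal_pdf_scalar.
Qed.

Definition tuple_of_colv {R : realType} {n} (v : 'cV[R]_n) : n.-tuple R :=
  [tuple v i ord0 | i < n].

Lemma integral_mvnormal_gauss {d} {Omega : measurableType d} {R : realType}
    {P : probability Omega R} {n} {X : {RV P >-> n.-tuple R}} {mu : 'cV[R]_n}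
    {s a : R} (y : n.-tuple R) :
  s != 0 -> 0 <= a -> mvnormal P X mu (s ^+ 2)%:M ->
  (\int[distribution P X]_x (gauss_kernel a x y)%:E =
  ((1 + a * s ^+ 2) `^ (- (n%:R / 2)) *
   gauss_kernel (a / (1 + a * s ^+ 2)) (tuple_of_colv mu) y)%:E)%E.
Proof.
move=> s0 a0 hX; rewrite (ge0_integral_mvnormal _ s0 hX).
- rewrite [X in integral_tuple X](_ : _ = fun x : n.-tuple R => (1 *
    \prod_(i < n) (normal_pdf (mu i ord0) s (tnth x i) *
      expR (- a * (tnth x i - tnth y i) ^+ 2 / 2)))%:E); last first.
    by apply/funext => x; rewrite gauss_kernelE -EFinM -big_split mul1r.
  rewrite (integral_tuple_prod (fun i t => normal_pdf (mu i ord0) s t *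
      expR (- a * (t - tnth y i) ^+ 2 / 2)) (fun i => (1 + a * s ^+ 2) `^ (- 2^-1) *
      expR (- (a / (1 + a * s ^+ 2)) * (mu i ord0 - tnth y i) ^+ 2 / 2)))//.
  + rewrite mul1r big_split/= prodr_const card_ord gauss_kernelE.
    rewrite -powR_mulrn ?powR_ge0// -powRrM mulNr (mulrC 2^-1).
    congr (_ * _)%:E.
    by apply: eq_bigr => i _; rewrite tnth_mktuple.
  + move=> i; apply: measurable_funM; first exact: measurable_normal_pdf.
    apply: measurableT_comp => //; apply: measurable_funM => //.
    apply: measurable_funM => //; apply: measurable_funX.
    exact: measurable_funB.
  + by move=> i x; rewrite mulr_ge0 ?normal_pdf_ge0 ?expR_ge0.
  + by move=> i; rewrite integral_normal_pdf_gauss.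
- by apply/measurable_EFinP; exact: measurable_gauss_kernel.
- by move=> x; rewrite lee_fin expR_ge0.
Qed.

(** * Conditional expectation given a generated sigma-algebra *)

Section conditional_expectation.
Context {d} {Omega : measurableType d} {R : realType}.
Variable P : probability Omega R.
Variable E0 : set (set Omega).
Hypothesis E0m : E0 `<=` measurable.

Notation Omega' := (g_sigma_algebraType E0).

Lemma g_sigma_algebra_sub (A : set Omega) : <<s E0 >> A -> measurable A.
Proof.
move=> EA; apply: EA; split => //; exact: sigma_algebra_measurable.
Qed.

Lemma g_sigma_algebraT : <<s E0 >> [set: Omega].
Proof. exact: (@measurableT _ Omega'). Qed.

Lemma measurable_coarsen : measurable_fun [set: Omega] (id : Omega -> Omega').
Proof. by move=> _ B mB; rewrite setTI; exact: g_sigma_algebra_sub. Qed.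

(** Pushing [P] forward along the identity into the coarser space is restricting [P] to the
    generated sigma-algebra, so measurability with respect to the latter becomes ordinary
    measurability on [Omega']. *)
Definition coarsen : {mfun Omega >-> Omega'} := mfun_of measurable_coarsen.

Definition restr_prob : probability Omega' R := distribution P coarsen.

Lemma measurable_coarse {d'} {U : measurableType d'} (Z : Omega -> U) :
  measurable_fun [set: Omega'] Z -> measurable_fun [set: Omega] Z.
Proof. by move=> mZ; apply: (measurableT_comp mZ measurable_coarsen). Qed.

Lemma ge0_integral_restr_prob (A : set Omega) (f : Omega -> \bar R) :
  <<s E0 >> A -> measurable_fun [set: Omega'] f -> (forall w, 0 <= f w)%E ->
  (\int[restr_prob]_(w in A) f w = \int[P]_(w in A) f w)%E.
Proof.
move=> EA mf f0; rewrite ge0_integral_pushforward//.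
exact: measurable_funTS.
Qed.

Lemma integrable_restr_prob (f : Omega -> \bar R) :
  measurable_fun [set: Omega'] f ->
  restr_prob.-integrable [set: Omega'] f <-> P.-integrable [set: Omega] f.
Proof.
move=> mf.
have maf : measurable_fun [set: Omega'] (abse \o f) by exact: measurableT_comp.
have E : (\int[restr_prob]_w `|f w| = \int[P]_w `|f w|)%E.
  exact: (ge0_integral_restr_prob setT (abse \o f) g_sigma_algebraT maf
    (fun w => abse_ge0 (f w))).
split => /integrableP[_ h]; apply/integrableP; split => //.
- exact: measurable_coarse.
- by rewrite -E.
- by rewrite E.
Qed.

Lemma integral_restr_prob (A : set Omega) (f : Omega -> \bar R) :
  <<s E0 >> A -> measurable_fun [set: Omega'] f ->
  P.-integrable [set: Omega] f ->
  (\int[restr_prob]_(w in A) f w = \int[P]_(w in A) f w)%E.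
Proof.
move=> EA mf intf; rewrite integral_pushforward//.
by apply: (integrableS measurableT) => //; exact: g_sigma_algebra_sub.
Qed.

Lemma cond_exp_measurable (V Z : Omega -> R) :
  is_cond_exp P <<s E0 >> V Z -> measurable_fun [set: Omega'] Z.
Proof. by case=> mZ _ _ _ B mB; rewrite setTI; exact: mZ. Qed.

(** Under the restricted probability both versions are measurable with equal integrals over all
    measurable sets; a null set there is also null for [P]. *)
Lemma cond_exp_unique (V Z1 Z2 : Omega -> R) :
  is_cond_exp P <<s E0 >> V Z1 -> is_cond_exp P <<s E0 >> V Z2 ->
  ae_eq P setT Z1 Z2.
Proof.
move=> h1 h2.
have mZ1 := cond_exp_measurable _ _ h1.
have mZ2 := cond_exp_measurable _ _ h2.
case: h1 h2 => [_ i1 e1] [_ i2 e2].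
have : ae_eq restr_prob setT (EFin \o Z1) (EFin \o Z2).
  apply: integral_ae_eq => //.
  - by apply/integrable_restr_prob => //; exact/measurable_EFinP.
  - exact/measurable_EFinP.
  - move=> A _ mA; rewrite !integral_restr_prob//.
    + by rewrite e1// e2.
    + exact/measurable_EFinP.
    + exact/measurable_EFinP.
case=> N [mN N0 sN]; exists N; split => //.
  exact: g_sigma_algebra_sub.
move=> w /= h; apply: sN => /=; apply: contra_not h => h _.
by have [] := h I.
Qed.

Lemma is_cond_exp_ae_eq (V V' Z : Omega -> R) :
  measurable_fun setT V -> measurable_fun setT V' -> ae_eq P setT V V' ->
  is_cond_exp P <<s E0 >> V Z -> is_cond_exp P <<s E0 >> V' Z.
Proof.
move=> mV mV' VV' [mZ iZ eZ]; split => // A EA; rewrite eZ//.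
have mA := g_sigma_algebra_sub _ EA.
apply: ae_eq_integral => //.
- by apply/measurable_EFinP; exact: measurable_funTS.
- by apply/measurable_EFinP; exact: measurable_funTS.
- by apply: filterS VV' => w /= h _; rewrite h.
Qed.

(** A true equality, not an a.e. one: the set of versions depends only on the a.e. class of [V], and
    [xget] chooses the same element from equal sets. *)
Lemma cond_exp_ae_eq (V V' : Omega -> R) :
  measurable_fun setT V -> measurable_fun setT V' -> ae_eq P setT V V' ->
  cond_exp P <<s E0 >> V = cond_exp P <<s E0 >> V'.
Proof.
move=> mV mV' VV'; congr xget; apply/seteqP; split => Z /=.
- exact: is_cond_exp_ae_eq.
- by apply: is_cond_exp_ae_eq => //; exact: ae_eq_sym.
Qed.

Lemma cond_expP (V Z : Omega -> R) :
  is_cond_exp P <<s E0 >> V Z ->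
  is_cond_exp P <<s E0 >> V (cond_exp P <<s E0 >> V).
Proof.
move=> h; apply: (@xgetPex _ _ [set Z | is_cond_exp P <<s E0 >> V Z]).
by exists Z.
Qed.

Lemma expectation_cond_exp (V Z : Omega -> R) :
  is_cond_exp P <<s E0 >> V Z ->
  ('E_P[cond_exp P <<s E0 >> V] = \int[P]_w (V w)%:E)%E.
Proof.
move=> /cond_expP[_ _ h]; rewrite unlock h//.
exact: g_sigma_algebraT.
Qed.

(** The chosen conditional means are a.e. 0 by uniqueness, so the centred product is a.e.
    [V1 \* V2], and [Z] ensures that its chosen conditional expectation is a genuine one. *)
Lemma expectation_cond_cov (V1 V2 Z : Omega -> R) :
  measurable_fun setT V1 -> measurable_fun setT V2 ->
  is_cond_exp P <<s E0 >> V1 (cst 0) ->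
  is_cond_exp P <<s E0 >> V2 (cst 0) ->
  is_cond_exp P <<s E0 >> (V1 \* V2) Z ->
  ('E_P[cond_cov P <<s E0 >> V1 V2] = \int[P]_w (V1 w * V2 w)%:E)%E.
Proof.
move=> mV1 mV2 h1 h2 hZ.
have c1 := cond_expP _ _ h1; have c2 := cond_expP _ _ h2.
rewrite -(expectation_cond_exp _ _ hZ) /cond_cov; congr expectation.
apply: cond_exp_ae_eq.
- by apply: measurable_funM; apply: measurable_funB => //;
    apply: measurable_coarse; apply: cond_exp_measurable; eassumption.
- exact: measurable_funM.
- have e1 := cond_exp_unique _ _ _ c1 h1; have e2 := cond_exp_unique _ _ _ c2 h2.
  by apply: filterS2 e1 e2 => w /= k1 k2 _; rewrite k1// k2// !subr0.
Qed.

End conditional_expectation.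

(** * Independence as a product law, and freezing *)

Section joint_law.
Context {d d'} {Omega : measurableType d} {V : measurableType d'}
  {R : realType}.
Variable P : probability Omega R.
Variable E0 : set (set Omega).
Hypothesis E0m : E0 `<=` measurable.
Variable S : {RV P >-> V}.
Hypothesis indS : independent_of_events P <<s E0 >> S.

Notation Omega' := (g_sigma_algebraType E0).
Notation P' := (restr_prob P E0 E0m).
Notation Q := (distribution P S).

Lemma measurable_graph :
  measurable_fun [set: Omega] (fun w => (w, S w) : Omega' * V).
Proof.
by apply: measurable_fun_pair => //; exact: measurable_coarsen.
Qed.

(** On rectangles this is the independence of [S] from the generated sigma-algebra. Coarsening
    matters: for the full sigma-algebra of [Omega], the law of [(w, S w)] lives on the graph of [S]
    and is in general no product. *)
Lemma joint_lawE (A : set (Omega' * V)) : measurable A ->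
  (P' \x Q)%E A = distribution P (mfun_of measurable_graph) A.
Proof.
apply: product_measure_unique => B C mB mC.
rewrite -(indS B C mB mC).
by rewrite /distribution /pushforward/=.
Qed.

Lemma ge0_integral_joint (g : Omega' * V -> \bar R) :
  measurable_fun setT g -> (forall z, 0 <= g z)%E ->
  (\int[(P' \x Q)%E]_z g z = \int[P]_w g (w, S w))%E.
Proof.
move=> mg g0.
rewrite (eq_measure_integral (distribution P (mfun_of measurable_graph))).
  by rewrite ge0_integral_distribution.
by move=> A mA _; exact: joint_lawE.
Qed.

Lemma integrable_joint (g : Omega' * V -> \bar R) :
  measurable_fun setT g ->
  P.-integrable [set: Omega] (fun w => g (w, S w)) ->
  (P' \x Q)%E.-integrable setT g.
Proof.
move=> mg /integrableP[_ ig]; apply/integrableP; split => //.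
by rewrite ge0_integral_joint//; exact: measurableT_comp.
Qed.

Lemma integral_joint (g : Omega' * V -> \bar R) :
  measurable_fun setT g ->
  P.-integrable [set: Omega] (fun w => g (w, S w)) ->
  (\int[(P' \x Q)%E]_z g z = \int[P]_w g (w, S w))%E.
Proof.
move=> mg ig.
rewrite (eq_measure_integral (distribution P (mfun_of measurable_graph))).
  by rewrite integral_distribution.
by move=> A mA _; exact: joint_lawE.
Qed.

Lemma is_cond_exp_freeze (g : Omega' * V -> R) :
  measurable_fun setT g ->
  P.-integrable [set: Omega] (fun w => (g (w, S w))%:E) ->
  is_cond_exp P <<s E0 >> (fun w => g (w, S w))
    (fun w => fine (\int[Q]_v (g (w, v))%:E)).
Proof.
move=> mg ig.
have mEg : measurable_fun setT (EFin \o g) by exact/measurable_EFinP.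
have iEg := integrable_joint _ mEg ig.
have iG := integrable_fubini_F iEg.
have mG := measurable_fubini_F iEg.
set G := fubini_F Q (EFin \o g) in iG mG.
have mZ : measurable_fun [set: Omega'] (fine \o G) by exact: measurableT_comp.
have iZ : P'.-integrable setT (EFin \o (fine \o G)).
  apply: le_integrable iG => //.
  - exact/measurable_EFinP.
  - by move=> w _ /=; case: (G w) => [r| |] //=; rewrite normr0 leey.
split.
- by move=> B mB; have := mZ measurableT B mB; rewrite setTI.
- by apply/(integrable_restr_prob P E0 E0m) => //; exact/measurable_EFinP.
- move=> A EA.
  have mA' : measurable (A : set Omega') by [].
  have mA := g_sigma_algebra_sub E0 E0m A EA.
  (* Integrating over [A] is integrating [g] times the indicator of [A], a function of the first
     coordinate alone, so Fubini for the product law applies. *)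
  have mh : measurable_fun [set: Omega' * V]
      (fun z => (g z * \1_A z.1)%:E).
    apply/measurable_EFinP; apply: measurable_funM => //.
    have m1 : measurable_fun [set: Omega'] (\1_A : Omega' -> R).
      exact: measurable_indic.
    exact: (measurableT_comp m1 measurable_fst).
  have ih : P.-integrable [set: Omega] (fun w => (g (w, S w) * \1_A w)%:E).
    apply: le_integrable ig => //.
    + exact: (measurableT_comp mh measurable_graph).
    + move=> w _ /=; rewrite lee_fin normrM indicE.
      by case: (w \in A); rewrite ?normr1 ?mulr1// normr0 mulr0.
  rewrite -(integral_restr_prob P E0 E0m A (EFin \o (fine \o G)))//; last 2 first.
  + exact/measurable_EFinP.
  + by apply/(integrable_restr_prob P E0 E0m) => //; exact/measurable_EFinP.
  transitivity (\int[P']_(w in A) G w)%E.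
    apply: ae_eq_integral => //.
    + by apply/measurable_EFinP; exact: measurable_funTS.
    + exact: measurable_funTS.
    (* [fine] alters the inner integral only where it is infinite, a null set by integrability. *)
    + have := integrable_ae measurableT iG.
      by apply: filterS => w /= h _; rewrite fineK//; exact: h.
  rewrite integral_mkcond.
  transitivity (\int[P']_w fubini_F Q (fun z => (g z * \1_A z.1)%:E) w)%E.
    apply: eq_integral => w _; rewrite /fubini_F/= patchE indicE.
    case: ifPn => wA.
      by apply: eq_integral => v _; rewrite mulr1.
    by rewrite -[LHS](integral0 Q setT); apply: eq_integral => v _; rewrite mulr0.
  rewrite (integral12_prod_meas1 (integrable_joint _ mh ih)) integral_joint//=.
  rewrite [RHS]integral_mkcond; apply: eq_integral => w _.
  by rewrite patchE indicE; case: ifPn => _; rewrite ?mulr1 ?mulr0.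
Qed.

End joint_law.

Lemma finite_measure_prod_unique {d1 d2} {T1 : measurableType d1}
    {T2 : measurableType d2} {R : realType}
    (m1 m2 : {measure set (T1 * T2) -> \bar R}) :
  (m1 setT < +oo)%E ->
  (forall A B, measurable A -> measurable B -> m1 (A `*` B) = m2 (A `*` B)) ->
  forall A, measurable A -> m1 A = m2 A.
Proof.
move=> m1oo m12 A mA.
apply: (measure_unique [set A `*` B | A in measurable & B in measurable]
  (fun=> setT)) => //.
- by rewrite measurable_prod_measurableType.
- move=> _ _ [A1 mA1 [B1 mB1 <-]] [A2 mA2 [B2 mB2 <-]].
  rewrite -setXI; exists (A1 `&` A2); first exact: measurableI.
  by exists (B1 `&` B2) => //; exact: measurableI.
- move=> _; exists setT; first exact: measurableT.
  by exists setT; [exact: measurableT|exact: setXTT].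
- by rewrite bigcup_const.
- by move=> _ [A1 mA1 [B1 mB1 <-]]; exact: m12.
Qed.

(** * Law of the three attributes *)

Section triple_law.
Context {d d'} {Omega : measurableType d} {V : measurableType d'}
  {R : realType}.
Variable P : probability Omega R.
Variables X Y W : {RV P >-> V}.
Hypothesis indXYW : mutually_independent3 P X Y W.

Definition rv_pair {d1 d2} {V1 : measurableType d1} {V2 : measurableType d2}
    (X1 : {mfun Omega >-> V1}) (X2 : {mfun Omega >-> V2}) :
    {mfun Omega >-> (V1 * V2)%type} :=
  mfun_of (measurable_fun_pair (measurable_funPT X1) (measurable_funPT X2)).

Lemma pair_lawE (A : set (V * V)) : measurable A ->
  (distribution P X \x distribution P Y)%E A = distribution P (rv_pair X Y) A.
Proof.
apply: product_measure_unique => B C mB mC.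
have := indXYW B C setT mB mC measurableT.
rewrite preimage_setT setIT => h.
transitivity (P (X @^-1` B `&` Y @^-1` C)) => //.
by rewrite h probability_setT mule1.
Qed.

Lemma pair_indep (A : set (V * V)) (C : set V) : measurable A -> measurable C ->
  P (rv_pair X Y @^-1` A `&` W @^-1` C) =
  (P (rv_pair X Y @^-1` A) * P (W @^-1` C))%E.
Proof.
move=> mA mC.
have mWC : measurable (W @^-1` C) by exact: measurable_funPTI.
have PW : P (W @^-1` C) \is a fin_num by exact: fin_num_measure.
pose c : {nonneg R} := NngNum (fine_ge0 (measure_ge0 P (W @^-1` C))).
have cE : P (W @^-1` C) = (c%:num)%:E by rewrite /= fineK.
have := @finite_measure_prod_unique _ _ V V R
  (pushforward (mrestr P mWC) (rv_pair X Y))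
  (mscale c (distribution P (rv_pair X Y))).
rewrite cE muleC; apply => //.
- rewrite /pushforward/= /mrestr.
  by rewrite (le_lt_trans (probability_le1 _ _)) ?ltry// preimage_setT setTI.
- move=> A1 B1 mA1 mB1.
  transitivity (P (X @^-1` A1 `&` Y @^-1` B1 `&` W @^-1` C)) => //.
  have h : (distribution P (rv_pair X Y) (A1 `*` B1) =
      P (X @^-1` A1) * P (Y @^-1` B1))%E.
    rewrite -pair_lawE; last exact: measurableX.
    exact: product_measure1E.
  transitivity ((c%:num)%:E * distribution P (rv_pair X Y) (A1 `*` B1))%E => //.
  by rewrite h -cE indXYW// muleC.
Qed.

Lemma triple_lawE (A : set (V * V * V)) : measurable A ->
  ((distribution P X \x distribution P Y) \x distribution P W)%E A =
  distribution P (rv_pair (rv_pair X Y) W) A.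
Proof.
move=> mA; pose PXY : probability (V * V)%type R :=
  (distribution P X \x distribution P Y)%E.
apply: (@product_measure_unique _ _ _ _ _ PXY (distribution P W)
  (distribution P (rv_pair (rv_pair X Y) W)) _ A mA) => B C mB mC.
transitivity (P (rv_pair X Y @^-1` B) * P (W @^-1` C))%E.
  by rewrite -pair_indep.
by congr (_ * _)%E; rewrite /PXY [RHS]pair_lawE.
Qed.

Lemma ge0_integral_triple (f : V * V * V -> \bar R) :
  measurable_fun setT f -> (forall z, 0 <= f z)%E ->
  (\int[distribution P (rv_pair (rv_pair X Y) W)]_z f z =
   \int[distribution P X]_x \int[distribution P Y]_y
     \int[distribution P W]_u f (x, y, u))%E.
Proof.
move=> mf f0; pose PXY : probability (V * V)%type R :=
  (distribution P X \x distribution P Y)%E.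
rewrite (eq_measure_integral (PXY \x distribution P W)%E); last first.
  by move=> A mA _; apply/esym/triple_lawE.
rewrite fubini_tonelli1// fubini_tonelli1//.
- exact: measurable_fun_fubini_tonelli_F.
- by move=> p; apply: integral_ge0 => u _; exact: f0.
Qed.

End triple_law.

(** * Gaussian kernels integrated over the attributes *)

Section gauss_triple.
Context {d} {Omega : measurableType d} {R : realType}.
Variables (P : probability Omega R) (n : nat).
Variables (X Y W : {RV P >-> n.-tuple R}) (mu : 'cV[R]_n) (s : R).
Hypothesis indXYW : mutually_independent3 P X Y W.
Hypothesis s0 : s != 0.
Hypothesis hX : mvnormal P X mu (s ^+ 2)%:M.
Hypothesis hY : mvnormal P Y mu (s ^+ 2)%:M.
Hypothesis hW : mvnormal P W mu (s ^+ 2)%:M.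

Local Notation p := (- (n%:R / 2)).

Lemma integral_probability_cst {d'} {U : measurableType d'}
    (mu' : probability U R) (c : \bar R) : (\int[mu']_u c = c)%E.
Proof.
rewrite (integral_cst mu' measurableT).
by rewrite [X in (c * X)%E](probability_setT mu') mule1.
Qed.

Lemma gauss_kernelxx (a : R) (x : n.-tuple R) : gauss_kernel a x x = 1.
Proof.
rewrite /gauss_kernel big1 ?mulr0 ?mul0r ?expR0// => i _.
by rewrite subrr expr0n.
Qed.

(** Since (1 + a)(1 + b/(1 + a)) = 1 + a + b, the constants of two successive integrations merge
    into one. *)
Lemma powR_gauss_comp (a b c : R) : 0 <= a -> 0 <= b ->
  (1 + a) `^ c * (1 + b / (1 + a)) `^ c = (1 + a + b) `^ c.
Proof.
move=> a0 b0; have a1 : 0 < 1 + a by rewrite ltr_pwDl.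
rewrite -powRM ?addr_ge0 ?divr_ge0// ?ltW//.
by rewrite mulrDr mulr1 mulrCA divff ?mulr1// gt_eqF.
Qed.

Lemma integral_mvnormal_gaussZ (Z : {RV P >-> n.-tuple R}) (k a : R)
    (y : n.-tuple R) :
  mvnormal P Z mu (s ^+ 2)%:M -> 0 <= k -> 0 <= a ->
  (\int[distribution P Z]_x (k * gauss_kernel a x y)%:E =
  (k * ((1 + a * s ^+ 2) `^ p *
    gauss_kernel (a / (1 + a * s ^+ 2)) y (tuple_of_colv mu)))%:E)%E.
Proof.
move=> hZ k0 a0; under eq_integral do rewrite EFinM.
rewrite ge0_integralZl_EFin//.
- by rewrite (integral_mvnormal_gauss y s0 a0 hZ) gauss_kernelC.
- by move=> x _; rewrite lee_fin expR_ge0.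
- by apply/measurable_EFinP; exact: measurable_gauss_kernel.
Qed.

(** In the iterated integral [y - u] is a centred normal vector with covariance 2 s^2 I, whence the
    2. *)
Lemma integral2_gauss (Z1 Z2 : {RV P >-> n.-tuple R}) (a : R) :
  mvnormal P Z1 mu (s ^+ 2)%:M -> mvnormal P Z2 mu (s ^+ 2)%:M -> 0 <= a ->
  (\int[distribution P Z1]_y \int[distribution P Z2]_u
    (gauss_kernel a y u)%:E = ((1 + 2 * (a * s ^+ 2)) `^ p)%:E)%E.
Proof.
move=> h1 h2 a0.
have as0 : 0 <= a * s ^+ 2 by rewrite mulr_ge0// sqr_ge0.
transitivity (\int[distribution P Z1]_y ((1 + a * s ^+ 2) `^ p *
    gauss_kernel (a / (1 + a * s ^+ 2)) y (tuple_of_colv mu))%:E)%E.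
  apply: eq_integral => y _.
  under eq_integral do rewrite gauss_kernelC -[gauss_kernel _ _ _]mul1r.
  by rewrite integral_mvnormal_gaussZ// mul1r.
rewrite integral_mvnormal_gaussZ ?powR_ge0 ?divr_ge0 ?addr_ge0//.
rewrite gauss_kernelxx mulr1 mulrAC powR_gauss_comp//.
by congr (_ `^ _)%:E; ring.
Qed.

Local Notation Q := (distribution P (rv_pair (rv_pair X Y) W)).

Local Notation V3 := (n.-tuple R * n.-tuple R * n.-tuple R)%type.

Let mX : measurable_fun setT (fun z : V3 => z.1.1).
Proof. exact: measurableT_comp. Qed.

Let mY : measurable_fun setT (fun z : V3 => z.1.2).
Proof. exact: measurableT_comp. Qed.

Let mW : measurable_fun setT (fun z : V3 => z.2).
Proof. exact: measurable_snd. Qed.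

Lemma integral_triple_gauss_XY (a : R) : 0 <= a ->
  (\int[Q]_z (gauss_kernel a z.1.1 z.1.2)%:E =
   ((1 + 2 * (a * s ^+ 2)) `^ p)%:E)%E.
Proof.
move=> a0; rewrite ge0_integral_triple//.
- transitivity (\int[distribution P X]_x \int[distribution P Y]_y
      (gauss_kernel a x y)%:E)%E; last exact: integral2_gauss.
  apply: eq_integral => x _.
  by apply: eq_integral => y _; rewrite /= integral_probability_cst.
- by apply/measurable_EFinP; exact: measurable_gauss_kernel.
- by move=> z; rewrite lee_fin expR_ge0.
Qed.

Lemma integral_triple_gauss_YW (a : R) : 0 <= a ->
  (\int[Q]_z (gauss_kernel a z.1.2 z.2)%:E =
   ((1 + 2 * (a * s ^+ 2)) `^ p)%:E)%E.
Proof.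
move=> a0; rewrite ge0_integral_triple//=.
- by rewrite integral_probability_cst integral2_gauss.
- by apply/measurable_EFinP; exact: measurable_gauss_kernel.
- by move=> z; rewrite lee_fin expR_ge0.
Qed.

(** For fixed [x] the integrals over [W] and [Y] are separate; each yields a factor [q] and a kernel
    of precision [b] centred at the mean, and the two kernels multiply to precision [b + b]. *)
Lemma integral_triple_gauss_XW_XY (a : R) : 0 <= a ->
  (\int[Q]_z (gauss_kernel a z.1.1 z.2 * gauss_kernel a z.1.1 z.1.2)%:E =
   ((1 + a * s ^+ 2) `^ p * (1 + 3 * (a * s ^+ 2)) `^ p)%:E)%E.
Proof.
move=> a0.
have as0 : 0 <= a * s ^+ 2 by rewrite mulr_ge0// sqr_ge0.
set q := (1 + a * s ^+ 2) `^ p.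
have q0 : 0 <= q by exact: powR_ge0.
set b := a / (1 + a * s ^+ 2).
have b0 : 0 <= b by rewrite divr_ge0 ?addr_ge0.
rewrite ge0_integral_triple//=; last 2 first.
- apply/measurable_EFinP; apply: measurable_funM;
    exact: measurable_gauss_kernel.
- by move=> z; rewrite lee_fin mulr_ge0 ?expR_ge0.
transitivity (\int[distribution P X]_x
    (q ^+ 2 * gauss_kernel (b + b) x (tuple_of_colv mu))%:E)%E.
  apply: eq_integral => x _.
  transitivity (\int[distribution P Y]_y
    ((q * gauss_kernel b x (tuple_of_colv mu)) * gauss_kernel a y x)%:E)%E.
    apply: eq_integral => y _.
    under eq_integral do rewrite mulrC [X in _ * X]gauss_kernelC.
    rewrite integral_mvnormal_gaussZ ?expR_ge0//.
    by rewrite mulrC [X in _ * X]gauss_kernelC.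
  rewrite integral_mvnormal_gaussZ ?mulr_ge0 ?expR_ge0//.
  by rewrite -/q -/b mulrACA gauss_kernelM expr2.
rewrite integral_mvnormal_gaussZ ?addr_ge0 ?sqr_ge0//.
rewrite gauss_kernelxx mulr1 expr2 -mulrA; congr (_ * _)%:E.
(* One of the two factors [q] merges with the last integration, as 1 + a s^2 + 2 a s^2 = 1 + 3 a
   s^2; the other remains. *)
rewrite (_ : (b + b) * s ^+ 2 = (2 * (a * s ^+ 2)) / (1 + a * s ^+ 2)).
  rewrite powR_gauss_comp//; first by congr (_ `^ _); ring.
  by rewrite mulr_ge0.
by rewrite /b; ring.
Qed.

End gauss_triple.

(** * Square integrability *)

Section square_integrable.
Context {d} {Omega : measurableType d} {R : realType}.
Variable P : probability Omega R.

Lemma Lfun2_of_sqr (f : Omega -> R) : measurable_fun setT f ->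
  (\int[P]_w (f w ^+ 2)%:E < +oo)%E -> f \in Lfun P 2%:E.
Proof.
move=> mf foo; rewrite inE; apply/andP; split; rewrite inE/=//.
rewrite /finite_norm unlock poweR_lty//.
under eq_integral do rewrite /= powR_mulrn// real_normK ?num_real//.
exact: foo.
Qed.

Lemma Lfun2_of_covariance (f : Omega -> R) (v : R) : measurable_fun setT f ->
  covariance P f f = v%:E -> f \in Lfun P 2%:E.
Proof.
move=> mf; rewrite unlock unlock => cv.
(* [c] is a real number even before [f] is known to be integrable, so the argument is not
   circular. *)
set c := fine _ in cv.
have h : (f \- cst c) \in Lfun P 2%:E.
  apply: Lfun2_of_sqr; first exact: measurable_funB.
  by rewrite (_ : (\int[P]_w _)%E = v%:E) ?ltry// -cv.
have -> : f = (f \- cst c) \+ cst c by apply/funext => w /=; rewrite subrK.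
by rewrite rpredD ?lee1n//= => _; rewrite Lfun_cst.
Qed.

Lemma ge0_integrable (f : Omega -> R) (c : R) :
  measurable_fun setT f -> (forall w, 0 <= f w) ->
  (\int[P]_w (f w)%:E = c%:E)%E -> P.-integrable setT (EFin \o f).
Proof.
move=> mf f0 fc; apply/integrableP; split; first exact/measurable_EFinP.
under eq_integral do rewrite /= ger0_norm//.
by rewrite fc ltry.
Qed.

End square_integrable.

(** * A skew random function evaluated at random points *)

Section skew_random_function.
Context {d d'} {Omega : measurableType d} {V : measurableType d'}
  {R : realType}.
Variable P : probability Omega R.
Variable F : V * V -> Omega -> R.
Hypothesis Fmeas : forall p, measurable_fun setT (F p).
Hypothesis Fjoint : measurable_random_function F.
Hypothesis Fskew : forall x y w, F (y, x) w = - F (x, y) w.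
Variable C : R.
Hypothesis FC : forall p, (\int[P]_w (F p w ^+ 2)%:E <= C%:E)%E.

Notation Omega' := (g_sigma_algebraType (events_of F)).
Notation sF := (sigma_of F).

Lemma events_of_measurable : events_of F `<=` measurable.
Proof.
by move=> _ [p [B [mB ->]]]; have := Fmeas p measurableT B mB; rewrite setTI.
Qed.

Notation P' := (restr_prob P (events_of F) events_of_measurable).

Lemma measurable_section (p : V * V) : measurable_fun [set: Omega'] (F p).
Proof.
move=> _ B mB; rewrite setTI; apply: sub_sigma_algebra.
by exists p, B.
Qed.

Lemma independent_of_events_comp {d1 d2} {V1 : measurableType d1}
    {V2 : measurableType d2} (G : set (set Omega)) (S : Omega -> V1)
    (phi : V1 -> V2) :
  measurable_fun setT phi -> independent_of_events P G S ->
  independent_of_events P G (phi \o S).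
Proof.
move=> mphi indS A B GA mB; rewrite comp_preimage; apply: indS => //.
by have := mphi measurableT B mB; rewrite setTI.
Qed.

Lemma measurable_eval {d1} {V1 : measurableType d1} (h : V1 -> V * V) :
  measurable_fun setT h ->
  measurable_fun setT (fun z : Omega' * V1 => F (h z.2) z.1).
Proof.
move=> mh.
have m : measurable_fun [set: Omega' * V1]
    (fun z => (h z.2, z.1) : (V * V) * Omega').
  by apply: measurable_fun_pair => //; exact: (measurableT_comp mh).
exact: (measurableT_comp Fjoint m).
Qed.

Lemma measurable_eval_at (S : {mfun Omega >-> (V * V)%type}) :
  measurable_fun setT (fun w => F (S w) w).
Proof.
exact: (measurableT_comp (measurable_eval id (@measurable_id _ _ setT))
  (measurable_graph P (events_of F) events_of_measurable S)).
Qed.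

(** By Tonelli the second moment of F(S) is the average of the second moments of [F p] over the law
    of [S], hence at most [C]. *)
Lemma Lfun2_eval_at (S : {RV P >-> (V * V)%type}) :
  independent_of_events P sF S -> (fun w => F (S w) w) \in Lfun P 2%:E.
Proof.
move=> indS; apply: Lfun2_of_sqr; first exact: measurable_eval_at.
have mg : measurable_fun setT
    (fun z : Omega' * (V * V) => (F z.2 z.1 ^+ 2)%:E).
  by apply/measurable_EFinP; apply: measurable_funX;
    exact: (measurable_eval id (@measurable_id _ _ setT)).
have g0 (z : Omega' * (V * V)) : (0 <= (F z.2 z.1 ^+ 2)%:E)%E.
  by rewrite lee_fin sqr_ge0.
rewrite -(ge0_integral_joint P (events_of F) events_of_measurable S indS
  (fun z => (F z.2 z.1 ^+ 2)%:E) mg g0).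
rewrite fubini_tonelli2// (@le_lt_trans _ _ C%:E) ?ltry//.
rewrite -[leRHS](integral_probability_cst (distribution P S)).
apply: ge0_le_integral => //.
- by move=> p _; apply: integral_ge0.
- exact: measurable_fun_fubini_tonelli_G.
- move=> p _; rewrite /fubini_G/= ge0_integral_restr_prob//.
  + exact: g_sigma_algebraT.
  + apply/measurable_EFinP; apply: measurable_funX.
    exact: measurable_section.
  + by move=> w; rewrite lee_fin sqr_ge0.
Qed.

(* No integrability is needed: a non-integrable f gives +oo - +oo = -oo, and
   fine -oo = 0. *)
Lemma skew_integral0 (S : {RV P >-> (V * V)%type}) (f : V * V -> R) :
  (forall A, measurable A ->
    P (S @^-1` (swap_pair @^-1` A)) = P (S @^-1` A)) ->
  measurable_fun setT f -> (forall p, f (swap_pair p) = - f p) ->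
  fine (\int[distribution P S]_p (f p)%:E)%E = 0.
Proof.
move=> Ssym mf fskew; rewrite integralE.
have mswap : measurable_fun setT (@swap_pair V V).
  exact: measurable_fun_pair.
have mE : measurable_fun setT (EFin \o f) by exact/measurable_EFinP.
have mEp := measurable_funepos mE.
have Epn : (\int[distribution P S]_p (EFin \o f)^\- p =
    \int[distribution P S]_p (EFin \o f)^\+ p)%E.
  rewrite [RHS](eq_measure_integral
    (distribution (distribution P S) (mfun_of mswap))); last first.
    by move=> A mA _; exact: (esym (Ssym A mA)).
  rewrite [RHS]ge0_integral_distribution//=.
  apply: eq_integral => p _.
  by rewrite /= funenegE funeposE /= fskew EFinN.
rewrite -[(fun p => (f p)%:E)]/(EFin \o f) Epn.
by case: (integral _ _ _) => [x| |] //=; rewrite subrr.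
Qed.

Lemma is_cond_exp_eval_at0 (S : {RV P >-> (V * V)%type}) :
  (forall A, measurable A ->
    P (S @^-1` (swap_pair @^-1` A)) = P (S @^-1` A)) ->
  independent_of_events P sF S ->
  is_cond_exp P sF (fun w => F (S w) w) (cst 0).
Proof.
move=> Ssym indS.
have iF : P.-integrable setT (fun w => (F (S w) w)%:E).
  apply/(Lfun1_integrable P (fun w => F (S w) w)).
  apply: Lfun_subset12; last exact: Lfun2_eval_at.
  exact: fin_num_measure.
have := is_cond_exp_freeze P (events_of F) events_of_measurable S indS
  (fun z => F z.2 z.1) (measurable_eval id (@measurable_id _ _ setT)) iF.
congr (is_cond_exp _ _ _ _); apply/funext => w /=.
apply: skew_integral0 => //.
  exact: (measurableT_comp (measurable_eval id (@measurable_id _ _ setT))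
    (measurable_fun_pair (measurable_cst _) (@measurable_id _ _ setT))).
by case=> x y; exact: Fskew.
Qed.

Section product.
Context {d1} {V1 : measurableType d1}.
Variables (h1 h2 : V1 -> V * V).
Hypothesis mh1 : measurable_fun setT h1.
Hypothesis mh2 : measurable_fun setT h2.
Variable S : {RV P >-> V1}.
Hypothesis indS : independent_of_events P sF S.

Let S1 : {RV P >-> (V * V)%type} :=
  mfun_of (measurableT_comp mh1 (measurable_funPT S)).
Let S2 : {RV P >-> (V * V)%type} :=
  mfun_of (measurableT_comp mh2 (measurable_funPT S)).

Let mg : measurable_fun setT
  (fun z : Omega' * V1 => F (h1 z.2) z.1 * F (h2 z.2) z.1).
Proof.
exact: measurable_funM (measurable_eval h1 mh1) (measurable_eval h2 mh2).
Qed.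

Let ig : P.-integrable setT
  (fun w => (F (h1 (S w)) w * F (h2 (S w)) w)%:E).
Proof.
apply/(Lfun1_integrable P (fun w => F (h1 (S w)) w * F (h2 (S w)) w)).
apply: (Lfun2_mul_Lfun1 (f := fun w => F (S1 w) w) (g := fun w => F (S2 w) w)).
- by apply: Lfun2_eval_at; exact: independent_of_events_comp.
- by apply: Lfun2_eval_at; exact: independent_of_events_comp.
Qed.

(** [h1] and [h2] read two argument pairs off the same random vector, so one statement covers the
    variance (equal pairs) and the covariance (pairs sharing an endpoint). *)
Lemma is_cond_exp_eval_prod :
  exists Z, is_cond_exp P sF (fun w => F (h1 (S w)) w * F (h2 (S w)) w) Z.
Proof.
eexists.
exact: (is_cond_exp_freeze P (events_of F) events_of_measurable S indS
  (fun z => F (h1 z.2) z.1 * F (h2 z.2) z.1) mg ig).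
Qed.

Lemma integral_eval_prod :
  (\int[P]_w (F (h1 (S w)) w * F (h2 (S w)) w)%:E =
   \int[distribution P S]_z \int[P]_w (F (h1 z) w * F (h2 z) w)%:E)%E.
Proof.
have mEg : measurable_fun setT
    (fun z : Omega' * V1 => (F (h1 z.2) z.1 * F (h2 z.2) z.1)%:E).
  exact/measurable_EFinP.
rewrite -(integral_joint P (events_of F) events_of_measurable S indS _ mEg ig).
(* Fubini puts the integral over outcomes inside, at fixed attributes, where the covariance of the
   process is known. *)
rewrite -integral21_prod_meas1; last exact: integrable_joint.
apply: eq_integral => z _; rewrite /fubini_G/= integral_restr_prob//.
- exact: g_sigma_algebraT.
- apply/measurable_EFinP; apply: measurable_funM; exact: measurable_section.
- apply/(Lfun1_integrable P (fun w => F (h1 z) w * F (h2 z) w)).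
  apply: Lfun2_mul_Lfun1; apply: Lfun2_of_sqr => //;
    exact: (le_lt_trans (FC _) (ltry _)).
Qed.

End product.

End skew_random_function.

Lemma integralZB {d} {U : measurableType d} {R : realType}
    (m : probability U R) (k cf cg : R) (f g : U -> R) :
  measurable_fun setT f -> measurable_fun setT g ->
  (forall u, 0 <= f u) -> (forall u, 0 <= g u) ->
  (\int[m]_u (f u)%:E = cf%:E)%E -> (\int[m]_u (g u)%:E = cg%:E)%E ->
  (\int[m]_u (k * (f u - g u))%:E = (k * (cf - cg))%:E)%E.
Proof.
move=> mf mg f0 g0 fE gE.
have fi := ge0_integrable m f cf mf f0 fE.
have gi := ge0_integrable m g cg mg g0 gE.
under eq_integral do rewrite EFinM.
rewrite integralZl//; last by apply: (integrableB _ fi gi).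
by rewrite integralB_EFin// fE gE.
Qed.

Lemma pair_law_swap {d d'} {Omega : measurableType d} {V : measurableType d'}
    {R : realType} (P : probability Omega R) (X Y : {RV P >-> V}) :
  (forall A B, measurable A -> measurable B ->
    P (X @^-1` A `&` Y @^-1` B) = P (X @^-1` A) * P (Y @^-1` B))%E ->
  (forall A, measurable A -> P (X @^-1` A) = P (Y @^-1` A)) ->
  forall A, measurable A ->
    P (rv_pair X Y @^-1` (swap_pair @^-1` A)) = P (rv_pair X Y @^-1` A).
Proof.
move=> ind XY A mA.
apply: (@finite_measure_prod_unique _ _ V V R (distribution P (rv_pair Y X))
  (distribution P (rv_pair X Y)) _ _ A mA).
  exact: (le_lt_trans (probability_le1 (distribution P (rv_pair Y X))
    measurableT) (ltry 1)).
move=> B C mB mC.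
transitivity (P (X @^-1` C `&` Y @^-1` B)).
  by rewrite setIC.
transitivity (P (X @^-1` B `&` Y @^-1` C)) => //.
by rewrite !ind// muleC XY// -(XY B).
Qed.

Section kernel.
Context {R : realType} {n : nat}.

Lemma se_kernel_gauss (su a : R) (Su : 'M[R]_n) (p q : n.-tuple R * n.-tuple R) :
  invmx Su = a%:M ->
  se_kernel su Su p q =
  su ^+ 2 * (gauss_kernel a p.1 q.1 * gauss_kernel a p.2 q.2).
Proof.
move=> SuE; rewrite /se_kernel SuE !quad_scalar /gauss_kernel -expRD.
have E x y : \sum_i ((colv x - colv y) i ord0) ^+ 2 =
    \sum_(i < n) (tnth x i - tnth y i) ^+ 2 :> R.
  by apply: eq_bigr => i _; rewrite !mxE.
by rewrite !E; congr (_ * expR _); ring.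
Qed.

(** With scalar attribute covariance, a scalar R forces the kernel to be isotropic; its precision is
    r^2 / s^2. *)
Lemma invmx_roughness (s r : R) (Su : 'M[R]_n) : s != 0 ->
  invmx Su *m (s ^+ 2)%:M = (r ^+ 2)%:M -> invmx Su = (r ^+ 2 / s ^+ 2)%:M.
Proof.
move=> s0; rewrite mul_mx_scalar => h.
have := congr1 (fun M => (s ^+ 2)^-1 *: M) h.
by rewrite scalerA mulVf ?sqrf_eq0// scale1r scale_scalar_mx mulrC.
Qed.

End kernel.

(** * Covariance of the skew difference *)

Section skew_covariance.
Context {d} {Omega : measurableType d} {R : realType}.
Variables (P : probability Omega R) (n : nat) (su a : R).
Local Notation I := (n.-tuple R * n.-tuple R)%type.
Variable U : I -> {RV P >-> R}.
Hypothesis Ucov : forall p q, covariance P (U p) (U q) =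
  (su ^+ 2 * (gauss_kernel a p.1 q.1 * gauss_kernel a p.2 q.2))%:E.
Local Notation F := (skew_diff (fun p => U p : Omega -> R)).
Hypothesis F0 : forall p, ('E_P[F p] = 0)%E.

Lemma Lfun2_process p : (U p : Omega -> R) \in Lfun P 2%:E.
Proof. by apply: Lfun2_of_covariance (Ucov p p); exact: measurable_funPT. Qed.

(** As [F] is centred, the product moment is a covariance, and any mean of [U] drops out. Of the
    four bilinear terms two pairs coincide, since the kernel is unchanged when both points are
    transposed; hence the 2. *)
Lemma integral_skew_diff (x y x' y' : n.-tuple R) :
  (\int[P]_w (F (x, y) w * F (x', y') w)%:E =
  (2 * su ^+ 2 * (gauss_kernel a x x' * gauss_kernel a y y' -
                  gauss_kernel a x y' * gauss_kernel a y x'))%:E)%E.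
Proof.
transitivity (covariance P (F (x, y)) (F (x', y'))).
  rewrite unlock !F0/= unlock; apply: eq_integral => w _ /=.
  by congr (_ * _)%:E; rewrite /= subr0.
rewrite (_ : F (x, y) = U (x, y) \- U (y, x))//.
rewrite (_ : F (x', y') = U (x', y') \- U (y', x'))//.
have L2 q : (U q : Omega -> R) \in Lfun P 2%:E by exact: Lfun2_process.
rewrite covarianceBl//; last by rewrite rpredB ?lee1n//= => _; exact: L2.
rewrite !covarianceBr//.
rewrite !Ucov/= -!EFinB; congr _%:E; ring.
Qed.

End skew_covariance.

Theorem mainTheorem1 (R : realType) (d : measure_display)
  (Omega : measurableType d) (P : probability Omega R)
  (T : nat) (hT : (1 <= T)%N)
  (Su : 'M[R]_T) (hSu : posdef Su) (su : R) (hsu : 0 < su)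
  (U : T.-tuple R * T.-tuple R -> {RV P >-> R})
  (hU : gaussian_process U)
  (hUcov : forall p q, covariance P (U p) (U q) = (se_kernel su Su p q)%:E)
  (F : T.-tuple R * T.-tuple R -> Omega -> R)
  (hF : F = skew_diff (fun p => U p : Omega -> R))
  (hF0 : forall p, ('E_P[F p] = 0)%E)
  (hFmeas : measurable_random_function F)
  (X Y W : {RV P >-> T.-tuple R}) (mu : 'cV[R]_T) (sx : R)
  (hX : mvnormal P X mu (sx ^+ 2)%:M)
  (hY : mvnormal P Y mu (sx ^+ 2)%:M)
  (hW : mvnormal P W mu (sx ^+ 2)%:M)
  (hXYW : mutually_independent3 P X Y W)
  (hXYWF : independent_of_events P (sigma_of F) (fun w => (X w, Y w, W w)))
  (r : R) (hr : 0 < r)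
  (hR : invmx Su *m (sx ^+ 2)%:M = (r ^+ 2)%:M) :
  shared_endpoint_correlation P F X Y W =
    ((1 + 2 * r ^+ 2) `^ (- (T%:R / 2))
     - (1 + r ^+ 2) `^ (- (T%:R / 2)) * (1 + 3 * r ^+ 2) `^ (- (T%:R / 2)))
    / (1 - (1 + 4 * r ^+ 2) `^ (- (T%:R / 2))).
Proof.
have sx0 : sx != 0.
  (* Otherwise [hR] would equate the zero matrix with r^2 I; a diagonal entry to compare exists
     because [T] is at least 1. *)
  apply/eqP => sx0; move: hR; rewrite sx0 expr0n/= mul_mx_scalar scale0r.
  move=> /(congr1 (fun M : 'M[R]_T => M (Ordinal hT) (Ordinal hT))).
  rewrite !mxE eqxx mulr1n => /eqP.
  by rewrite eq_sym sqrf_eq0 gt_eqF.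
pose a := r ^+ 2 / sx ^+ 2.
have a0 : 0 <= a by rewrite divr_ge0 ?sqr_ge0.
have asE : a * sx ^+ 2 = r ^+ 2 by rewrite /a divfK// sqrf_eq0.
have SuE := invmx_roughness sx r Su sx0 hR.
have Ucov p q : covariance P (U p) (U q) =
    (su ^+ 2 * (gauss_kernel a p.1 q.1 * gauss_kernel a p.2 q.2))%:E.
  by rewrite hUcov (se_kernel_gauss su a Su p q SuE).
have FF x y x' y' : (\int[P]_w (F (x, y) w * F (x', y') w)%:E =
    (2 * su ^+ 2 * (gauss_kernel a x x' * gauss_kernel a y y' -
                  gauss_kernel a x y' * gauss_kernel a y x'))%:E)%E.
  rewrite hF; apply: integral_skew_diff => // p.
  by rewrite -hF.
have Fmeas p : measurable_fun setT (F p).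
  by rewrite hF; apply: measurable_funB; exact: measurable_funPT.
have Fskew x y w : F (y, x) w = - F (x, y) w.
  by rewrite hF /skew_diff/= opprB.
(* The second moment is 2 su^2 (1 - g(x,y)^2), which gives the uniform constant. *)
have FC p : (\int[P]_w (F p w ^+ 2)%:E <= (2 * su ^+ 2)%:E)%E.
  case: p => x y; under eq_integral do rewrite expr2.
  rewrite FF lee_fin ler_piMr// ?(mulr_ge0 _ (sqr_ge0 su))//.
  by rewrite !gauss_kernelxx mulr1 gerBl mulr_ge0 ?expR_ge0.
have lawE (Z1 Z2 : {RV P >-> T.-tuple R}) : mvnormal P Z1 mu (sx ^+ 2)%:M ->
    mvnormal P Z2 mu (sx ^+ 2)%:M -> forall A, measurable A ->
    P (Z1 @^-1` A) = P (Z2 @^-1` A).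
  by move=> h1 h2 A mA; rewrite h1// h2.
pose S := rv_pair (rv_pair X Y) W.
have indS : independent_of_events P (sigma_of F) S by [].
pose h2 (z : T.-tuple R * T.-tuple R * T.-tuple R) := (z.1.1, z.2).
have mh2 : measurable_fun setT h2.
  by apply: measurable_fun_pair => //; exact: measurableT_comp.
have mh1 : measurable_fun setT
  (fst : T.-tuple R * T.-tuple R * T.-tuple R -> T.-tuple R * T.-tuple R).
  exact: measurable_fst.
have indXY : independent_of_events P (sigma_of F) (rv_pair X Y).
  exact: (independent_of_events_comp _ (sigma_of F) S fst mh1 indS).
have indXW : independent_of_events P (sigma_of F) (rv_pair X W).
  exact: (independent_of_events_comp _ (sigma_of F) S h2 mh2 indS).
have z1 := is_cond_exp_eval_at0 P F Fmeas hFmeas Fskew _ FC (rv_pair X Y).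
have z2 := is_cond_exp_eval_at0 P F Fmeas hFmeas Fskew _ FC (rv_pair X W).
have m1 := measurable_eval_at P F Fmeas hFmeas (rv_pair X Y).
have m2 := measurable_eval_at P F Fmeas hFmeas (rv_pair X W).
have {}z1 : is_cond_exp P (sigma_of F) (eval_at F X Y) (cst 0).
  apply: z1 => //; apply: pair_law_swap; last exact: lawE.
  move=> A B mA mB; have := hXYW A B setT mA mB measurableT.
  by rewrite preimage_setT setIT probability_setT mule1.
have {}z2 : is_cond_exp P (sigma_of F) (eval_at F X W) (cst 0).
  apply: z2 => //; apply: pair_law_swap; last exact: lawE.
  move=> A B mA mB; have := hXYW A setT B mA measurableT mB.
  by rewrite preimage_setT setIT probability_setT mule1.
have [Z11 hZ11] := is_cond_exp_eval_prod P F Fmeas hFmeas _ FC _ _ mh1 mh1 S indS.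
have [Z12 hZ12] := is_cond_exp_eval_prod P F Fmeas hFmeas _ FC _ _ mh1 mh2 S indS.
have varE : variance_F P F X Y =
    2 * su ^+ 2 * (1 - (1 + 4 * r ^+ 2) `^ (- (T%:R / 2))).
  rewrite /variance_F /cond_var.
  rewrite (expectation_cond_cov P (events_of F)
    (events_of_measurable F Fmeas) _ _ Z11 m1 m1 z1 z1 hZ11).
  rewrite (integral_eval_prod P F Fmeas hFmeas _ FC _ _ mh1 mh1 S indS).
  (* The 4 is 2 times 2: squaring the kernel doubles its precision, and the difference of two draws
     has twice the variance. *)
  rewrite (_ : 4 * r ^+ 2 = 2 * ((a + a) * sx ^+ 2)); last first.
    by rewrite (mulrDl a a) asE; ring.
  transitivity (fine (\int[distribution P S]_z
    (2 * su ^+ 2 * (1 - gauss_kernel (a + a) z.1.1 z.1.2))%:E)%E).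
    congr fine; apply: eq_integral => -[[x y] u] _ /=.
    by rewrite FF !gauss_kernelxx mulr1 (gauss_kernelC a y x) gauss_kernelM.
  rewrite (integralZB (distribution P S) _ 1
    ((1 + 2 * ((a + a) * sx ^+ 2)) `^ (- (T%:R / 2))))//.
  - by apply: measurable_gauss_kernel; exact: measurableT_comp.
  - by move=> z; exact: expR_ge0.
  - by rewrite integral_probability_cst.
  - exact: (integral_triple_gauss_XY P T X Y W mu sx hXYW sx0 hX hY (a + a)
      (addr_ge0 a0 a0)).
have covE : fine ('E_P[cond_cov P (sigma_of F) (eval_at F X Y)
      (eval_at F X W)])%E =
    2 * su ^+ 2 * ((1 + 2 * r ^+ 2) `^ (- (T%:R / 2)) -
      (1 + r ^+ 2) `^ (- (T%:R / 2)) * (1 + 3 * r ^+ 2) `^ (- (T%:R / 2))).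
  rewrite (expectation_cond_cov P (events_of F)
    (events_of_measurable F Fmeas) _ _ Z12 m1 m2 z1 z2 hZ12).
  rewrite (integral_eval_prod P F Fmeas hFmeas _ FC _ _ mh1 mh2 S indS).
  transitivity (fine (\int[distribution P S]_z
    (2 * su ^+ 2 * (gauss_kernel a z.1.2 z.2 -
      gauss_kernel a z.1.1 z.2 * gauss_kernel a z.1.1 z.1.2))%:E)%E).
    congr fine; apply: eq_integral => -[[x y] u] _ /=.
    by rewrite FF gauss_kernelxx mul1r (gauss_kernelC a y x).
  rewrite -asE (integralZB (distribution P S) _
    ((1 + 2 * (a * sx ^+ 2)) `^ (- (T%:R / 2)))
    ((1 + a * sx ^+ 2) `^ (- (T%:R / 2)) *
     (1 + 3 * (a * sx ^+ 2)) `^ (- (T%:R / 2))))//.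
  - by apply: measurable_gauss_kernel => //; exact: measurableT_comp.
  - by apply: measurable_funM; apply: measurable_gauss_kernel => //;
      exact: measurableT_comp.
  - by move=> z; exact: expR_ge0.
  - by move=> z; rewrite mulr_ge0 ?expR_ge0.
  - exact: (integral_triple_gauss_YW P T X Y W mu sx hXYW sx0 hY hW a a0).
  - exact: (integral_triple_gauss_XW_XY P T X Y W mu sx hXYW sx0 hX hY hW a a0).
rewrite /shared_endpoint_correlation varE covE.
(* The inverse of the remaining variance factor stands on both sides, so only the common prefactor
   has to be cancelled. *)
have k0 : 2 * su ^+ 2 != 0 by rewrite mulf_neq0 ?sqrf_eq0 ?gt_eqF.
by rewrite invfM mulrACA mulVf// mul1r mulrC.
Qed.
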